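(* For every pointed lattice $\mathbf{A}$ the following are equivalent: (i) $\mathbf{A}$ is semi-prime-pointed; (ii) $\mathbf{A}$ is up-distributive at $\mathsf{1}$ and decomposable at $\mathsf{1}$; (iii) $\mathbf{A}$ satisfies $(\alpha_2)$ and is decomposable at $\mathsf{1}$; (iv) $\bigcap_{i\in I}\Theta_+(F_i)=\Delta_{\mathbf{A}}$ for some family $(F_i)_{i\in I}$ of prime $\mathsf{1}$-filters of $\mathbf{A}$. If $\mathbf{A}$ is finite, these are also equivalent to: (v) $\mathbf{A}$ is up-distributive at $\mathsf{1}$ and for every family $(F_i)_{i\in I}$ of prime $\mathsf{1}$-filters of $\mathbf{A}$ with $\bigcap_{i\in I}F_i={\uparrow}\mathsf{1}$ we have $\bigcap_{i\in I}\Theta_+(F_i)=\Delta_{\mathbf{A}}$.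
   Context: A pointed lattice is a lattice with a constant $\mathsf{1}$. It is prime-pointed if $x\vee y\geq\mathsf{1}$ implies $x\geq\mathsf{1}$ or $y\geq\mathsf{1}$, and semi-prime-pointed if it is isomorphic to a subdirect product of prime-pointed lattices. Up-distributive at $\mathsf{1}$: $x\vee y\geq\mathsf{1}$ and $x\vee z\geq\mathsf{1}$ imply $x\vee(y\wedge z)\geq\mathsf{1}$. $(\alpha_2)$: $x\vee y\geq\mathsf{1}$ implies $(x\wedge z)\vee(y\wedge z)\geq\mathsf{1}\wedge z$. Decomposable at $\mathsf{1}$: for all $n\geq 2$ and $x_1,\dots,x_n\in\mathbf{A}$, if $x_1\vee\dots\vee x_n=\mathsf{1}$ then $\mathrm{Cg}^{\mathbf{A}}\langle x_1,\mathsf{1}\rangle\cap\dots\cap\mathrm{Cg}^{\mathbf{A}}\langle x_n,\mathsf{1}\rangle=\Delta_{\mathbf{A}}$, where $\mathrm{Cg}^{\mathbf{A}}$ denotes the generated congruence and $\Delta_{\mathbf{A}}$ the identity relation. A $\mathsf{1}$-filter is a lattice filter containing $\mathsf{1}$; it is prime if $a\vee b\in F$ implies $a\in F$ or $b\in F$. ${\uparrow}\mathsf{1}=\{a: a\geq\mathsf{1}\}$. For a prime $\mathsf{1}$-filter $F$, $\Theta_+(F):=\mathrm{Cg}^{\mathbf{A}}\{\langle f\wedge\mathsf{1},\mathsf{1}\rangle: f\in F\}$. The intersection of an empty family of filters is the whole universe.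
   Formalization: In (v) the families of prime 1-filters are taken to be nonempty; with the empty family allowed, (i) ⇒ (v) fails for the two-element lattice whose constant 1 is its least element. *)

(* Defs.v *)
From HB Require Import structures.
From mathcomp Require Import all_boot all_order.
From mathcomp Require Import boolp classical_sets cardinality.

Set Implicit Arguments.
Unset Strict Implicit.
Unset Printing Implicit Defensive.

Import Order.Theory.

Local Open Scope classical_set_scope.
Local Open Scope order_scope.

HB.mixin Record isPointedLattice (d : Order.disp_t) L of Order.Lattice d L := {
  pone : L
}.

#[short(type="pointedLatticeType")]
HB.structure Definition PointedLattice (d : Order.disp_t) :=
  {L of Order.Lattice d L & isPointedLattice d L}.

Section PointedLatticeProperties.
Variables (d : Order.disp_t) (A : pointedLatticeType d).

Definition prime_pointed : Prop :=
  forall x y : A, pone <= Order.join x y -> pone <= x \/ pone <= y.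

Definition up_distributive : Prop :=
  forall x y z : A, pone <= Order.join x y -> pone <= Order.join x z ->
    pone <= Order.join x (Order.meet y z).

Definition alpha2 : Prop :=
  forall x y z : A, pone <= Order.join x y ->
    Order.meet pone z <= Order.join (Order.meet x z) (Order.meet y z).

(* Compatibility with the constant is automatic, by reflexivity. *)
Record congruence (R : set (A * A)) : Prop := Congruence {
  congr_refl : forall x, R (x, x);
  congr_sym : forall x y, R (x, y) -> R (y, x);
  congr_trans : forall x y z, R (x, y) -> R (y, z) -> R (x, z);
  congr_meet : forall x x' y y', R (x, x') -> R (y, y') ->
    R (Order.meet x y, Order.meet x' y');
  congr_join : forall x x' y y', R (x, x') -> R (y, y') ->
    R (Order.join x y, Order.join x' y')
}.

Definition Cg (G : set (A * A)) : set (A * A) := smallest congruence G.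

(* A has no least element in general, so the join x_0 \/ ... \/ x_n has no
   neutral element to start from: it is folded over x_1, ..., x_n from x_0. *)
Definition join_fam (n : nat) (x : 'I_n.+1 -> A) : A :=
  \big[Order.join/x ord0]_(i < n) x (lift ord0 i).

(* Families of length at least 2 are those indexed by some 'I_n.+2. *)
Definition decomposable : Prop :=
  forall (n : nat) (x : 'I_n.+2 -> A), join_fam x = pone ->
    \bigcap_(i in [set: 'I_n.+2]) Cg [set (x i, pone)] = diagonal.

Record one_filter (F : set A) : Prop := OneFilter {
  one_filter_one : F pone;
  one_filter_up : forall a b, a <= b -> F a -> F b;
  one_filter_meet : forall a b, F a -> F b -> F (Order.meet a b)
}.

(* The improper filter setT counts as prime. *)
Definition prime_one_filter (F : set A) : Prop :=
  one_filter F /\ forall a b, F (Order.join a b) -> F a \/ F b.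

Definition up_one : set A := [set a | pone <= a].

Definition Theta_plus (F : set A) : set (A * A) :=
  Cg [set (Order.meet f pone, pone) | f in F].

End PointedLatticeProperties.

Arguments prime_pointed {d} A.
Arguments up_distributive {d} A.
Arguments alpha2 {d} A.
Arguments decomposable {d} A.
Arguments up_one {d} A.

Section SubdirectProducts.
Variables (d : Order.disp_t) (I : Type) (B : I -> pointedLatticeType d).

Definition prod_one : forall i, B i := fun=> pone.
Definition prod_meet (x y : forall i, B i) : forall i, B i :=
  fun i => Order.meet (x i) (y i).
Definition prod_join (x y : forall i, B i) : forall i, B i :=
  fun i => Order.join (x i) (y i).

Record subdirect_product (S : set (forall i, B i)) : Prop := SubdirectProduct {
  subdirect_one : S prod_one;
  subdirect_meet : forall x y, S x -> S y -> S (prod_meet x y);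
  subdirect_join : forall x y, S x -> S y -> S (prod_join x y);
  subdirect_onto : forall i (b : B i), exists2 x, S x & x i = b
}.

Record isomorphism_onto (A : pointedLatticeType d) (S : set (forall i, B i))
    (f : A -> forall i, B i) : Prop := IsomorphismOnto {
  iso_one : f pone = prod_one;
  iso_meet : forall x y, f (Order.meet x y) = prod_meet (f x) (f y);
  iso_join : forall x y, f (Order.join x y) = prod_join (f x) (f y);
  iso_inj : injective f;
  iso_image : range f = S
}.

End SubdirectProducts.

(* The display d is a mere printing tag, so sharing it loses no generality. *)
Definition semi_prime_pointed (d : Order.disp_t) (A : pointedLatticeType d) :
    Prop :=
  exists (I : Type) (B : I -> pointedLatticeType d)
         (S : set (forall i, B i)) (f : A -> forall i, B i),
    [/\ forall i, prime_pointed (B i), subdirect_product S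
      & isomorphism_onto S f].

Definition some_family_separates (d : Order.disp_t)
    (A : pointedLatticeType d) : Prop :=
  exists (I : Type) (F : I -> set A),
    (forall i, prime_one_filter (F i)) /\
    \bigcap_(i in [set: I]) Theta_plus (F i) = diagonal.

(* Families are nonempty here. If pone is the least element of A, the empty
   family of filters has intersection setT = up_one A, whereas the empty family
   of congruences has intersection setT, which is not the diagonal unless A is
   trivial, although such an A is always prime-pointed. *)
Definition every_family_separates (d : Order.disp_t)
    (A : pointedLatticeType d) : Prop :=
  forall (I : Type) (F : I -> set A), inhabited I ->
    (forall i, prime_one_filter (F i)) ->
    \bigcap_(i in [set: I]) F i = up_one A ->
    \bigcap_(i in [set: I]) Theta_plus (F i) = diagonal.

(* Main.v *)
(** A quotient of [A] is prime-pointed exactly when the elements lying above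
    the point in the quotient form a prime 1-filter of [A].  If [F] is a prime
    1-filter, then [F] and its complement are the classes of a congruence that
    contains [Theta_plus F]; hence the filter attached to the quotient by
    [Theta_plus F] is [F] itself, and this quotient is prime-pointed.

    From decomposability to prime filters: given [a <> b], call [x] bad if
    [(a, b)] is in [Cg (x /\ 1, 1)].  Decomposability says that no finite join
    of bad elements is above the point, so an ideal maximal among those that
    contain the bad elements and avoid the point exists, and by
    up-distributivity its complement [F] is a prime 1-filter.  As
    [Theta_plus F] is the directed union of the [Cg (f /\ 1, 1)], [f] in [F],
    it does not contain [(a, b)].

    If [A] is finite, every prime 1-filter is principal, say generated by
    [p <= 1], and [Theta_plus F = Cg (p, 1)]; a family of such filters
    intersects to the up-set of the point iff the generators join to it. *)

Require Import Defs.
From HB Require Import structures.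
From mathcomp Require Import all_boot all_order.
From mathcomp Require Import boolp classical_sets cardinality.
From mathcomp Require Import generic_quotient.

Set Implicit Arguments.
Unset Strict Implicit.
Unset Printing Implicit Defensive.

Import Order.Theory.

Local Open Scope order_scope.
Local Open Scope classical_set_scope.

(** * Finite joins, truncation at the point, and [(alpha_2)] *)

Section FiniteJoins.
Variables (d : Order.disp_t) (A : pointedLatticeType d).
Implicit Types (x y z c : A) (s : seq A).

Definition join_seq x s : A := foldr Order.join x s.

Lemma join_seq_le x s c : (join_seq x s <= c) = all (<= c) (x :: s).
Proof.
elim: s => [|y s IH] /=; first by rewrite andbT.
by rewrite leUx IH /=; case: (y <= c); case: (x <= c).
Qed.

Lemma le_join_seq x s y : y \in x :: s -> y <= join_seq x s.
Proof. by have := lexx (join_seq x s); rewrite join_seq_le => /allP; exact. Qed.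

Lemma le_join_fam n (x : 'I_n.+1 -> A) i : x i <= join_fam x.
Proof.
rewrite /join_fam; case: (unliftP ord0 i) => [j|] ->.
  by rewrite (bigD1_seq j) ?index_enum_uniq ?mem_index_enum//= leUl.
by elim/big_rec: _ => // j z _ /le_trans-> //; rewrite leUr.
Qed.

Lemma join_fam_le n (x : 'I_n.+1 -> A) c :
  (forall i, x i <= c) -> join_fam x <= c.
Proof.
move=> xc; rewrite /join_fam; elim/big_ind: _ => // u v uc vc.
by rewrite leUx uc vc.
Qed.

Lemma join_fam_seq x s :
  join_fam (fun i : 'I_(size s).+1 => nth x (x :: s) i) = join_seq x s.
Proof.
apply/le_anti/andP; split.
  by apply: join_fam_le => i; apply/le_join_seq/mem_nth/ltn_ord.
rewrite join_seq_le; apply/allP => y ys.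
have iy : (index y (x :: s) < (size s).+1)%N by rewrite index_mem.
have := le_join_fam (fun i : 'I_(size s).+1 => nth x (x :: s) i) (Ordinal iy).
by rewrite /= -[X in X <= _]/(nth x (x :: s) (index y (x :: s))) nth_index.
Qed.

(** Entries are truncated one at a time, applying up-distributivity to each entry and [pone]. *)
Lemma up_distributive_join_seq x s : up_distributive A ->
  pone <= join_seq x s ->
  pone <= join_seq (Order.meet x pone) [seq Order.meet y pone | y <- s].
Proof.
move=> ud le1; set t := join_seq _ _.
(* The accumulator [c] collects the entries already passed. With no least element to start from, it
   is finally set to [t], which idempotence absorbs. *)
have truncate c : pone <= Order.join c (join_seq x s) -> pone <= Order.join c t.
  rewrite {}/t; elim: s c {le1} => [|y s IH] c /= le1.
    by apply: ud => //; rewrite leUr.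
  move: le1; rewrite -/(join_seq x s) joinA => /IH.
  set t := join_seq _ _; rewrite joinAC => le1.
  by rewrite [Order.join (Order.meet _ _) _]joinC joinA; apply: ud; rewrite ?leUr.
by have := truncate t; rewrite joinxx; apply; rewrite (le_trans le1)// leUr.
Qed.

(** Two uses of [alpha2]: on [x, z] cut at [pone] it puts [pone] below [x \/ (1 /\ z)]; on [x, y]
    cut at [z] it puts [1 /\ z] below [x \/ (y /\ z)]. *)
Lemma alpha2_up_distributive : alpha2 A -> up_distributive A.
Proof.
move=> a2 x y z xy xz.
have : pone <= Order.join x (Order.meet pone z).
  apply: le_trans (_ : Order.join (Order.meet x pone) (Order.meet z pone) <= _).
    by have := a2 _ _ pone xz; rewrite meetxx.
  by rewrite [Order.meet z _]meetC leU2 ?leIl.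
move/le_trans; apply; rewrite leUx leUl /= (le_trans (a2 _ _ z xy))//.
by rewrite leU2 ?leIl.
Qed.

End FiniteJoins.

(** * Generated congruences and [Theta_plus] *)

Section Congruences.
Variables (d : Order.disp_t) (A : pointedLatticeType d).
Implicit Types (G R : set (A * A)) (F : set A) (x y a b : A).

Lemma Cg_congruence G : congruence (Cg G).
Proof.
split=> [x|x y Rxy|x y z Rxy Ryz|x x' y y' Rx Ry|x x' y y' Rx Ry] R [cR GR].
- exact: congr_refl.
- by apply: congr_sym => //; apply: Rxy.
- by apply: (congr_trans cR (y := y)); [apply: Rxy|apply: Ryz].
- by apply: congr_meet => //; [apply: Rx|apply: Ry].
- by apply: congr_join => //; [apply: Rx|apply: Ry].
Qed.

Lemma bigcap_Cg_diagonal (I : Type) (G : I -> set (A * A)) :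
  \bigcap_(i in [set: I]) Cg (G i) = diagonal <->
  forall a b, (forall i, Cg (G i) (a, b)) -> a = b.
Proof.
split=> [GE a b ab|Gdiag].
  by suff : diagonal (a, b) by []; rewrite -GE => i _.
apply/seteqP; split=> [[a b] ab|[a b] /diagonalP->] /=.
  by apply: Gdiag => i; exact: ab.
by move=> i _; exact: (congr_refl (Cg_congruence _)).
Qed.

Lemma Cg1_sub x y R : congruence R -> R (x, y) -> Cg [set (x, y)] `<=` R.
Proof. by move=> cR Rxy; apply: smallest_sub => // _ ->. Qed.

(** Joining the generating pair [(x, pone)] with [y] yields [(y, pone)]. *)
Lemma Cg1_anti x y : x <= y -> y <= pone ->
  Cg [set (y, pone)] `<=` Cg [set (x, pone)].
Proof.
move=> xy y1; apply: Cg1_sub; first exact: Cg_congruence.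
have cg := Cg_congruence [set (x, pone)].
have : Cg [set (x, pone)] (Order.join x y, Order.join pone y).
  by apply: (congr_join cg); [exact: sub_gen_smallest|exact: congr_refl].
by rewrite (join_r xy) (join_l y1).
Qed.

(** The union is directed: by [Cg1_anti], the congruence of [f /\ g] contains those of [f] and [g],
    so any two pairs can be combined inside one principal congruence. *)
Lemma Theta_plus_union F : one_filter F ->
  Theta_plus F =
    [set p | exists2 f, F f & Cg [set (Order.meet f pone, pone)] p].
Proof.
move=> [F1 Fup FI]; apply/seteqP; split; last first.
  move=> p [f Ff]; apply: Cg1_sub; first exact: Cg_congruence.
  by apply: sub_gen_smallest; exists f.
have common f g p q : F f -> F g ->
    Cg [set (Order.meet f pone, pone)] p ->
    Cg [set (Order.meet g pone, pone)] q ->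
    exists2 h, F h & Cg [set (Order.meet h pone, pone)] p /\
                     Cg [set (Order.meet h pone, pone)] q.
  move=> Ff Fg fp gq; exists (Order.meet f g); first exact: FI.
  by split; [move: p fp|move: q gq]; apply: Cg1_anti;
    rewrite ?leIr// leI2 ?leIl ?leIr.
apply: smallest_sub; last first.
  by move=> _ [f Ff <-]; exists f => //; exact: sub_gen_smallest.
split=> [x|x y [f Ff fp]|x y z [f Ff fp] [g Fg gp]
  |x x' y y' [f Ff fp] [g Fg gp]|x x' y y' [f Ff fp] [g Fg gp]].
- by exists pone => //; apply: (congr_refl (Cg_congruence _)).
- by exists f => //; exact: (congr_sym (Cg_congruence _)).
- have [h Fh [hp hq]] := common _ _ _ _ Ff Fg fp gp; exists h => //.
  exact: (congr_trans (Cg_congruence _) hp hq).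
- have [h Fh [hp hq]] := common _ _ _ _ Ff Fg fp gp; exists h => //.
  exact: (congr_meet (Cg_congruence _) hp hq).
- have [h Fh [hp hq]] := common _ _ _ _ Ff Fg fp gp; exists h => //.
  exact: (congr_join (Cg_congruence _) hp hq).
Qed.

(** Membership in [F] respects meets because [F] is a filter and joins because it is prime, so
    having the same membership status is a congruence. *)
Lemma Theta_plus_prime F a b : prime_one_filter F ->
  Theta_plus F (a, b) -> (F a <-> F b).
Proof.
move=> [[F1 Fup FI] Fpr].
have FIE x y : F (Order.meet x y) <-> F x /\ F y.
  split=> [Fxy|[]]; last exact: FI.
  by split; apply: Fup Fxy; rewrite ?leIl ?leIr.
have FUE x y : F (Order.join x y) <-> F x \/ F y.
  by split=> [|[]]; [exact: Fpr|apply: Fup; rewrite leUl|apply: Fup; rewrite leUr].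
suff : Theta_plus F `<=` [set p | F p.1 <-> F p.2] by apply.
apply: smallest_sub; last by move=> _ [f Ff <-] /=; split => // _; apply: FI.
by split=> /= *; rewrite ?FIE ?FUE; tauto.
Qed.

Lemma prime_filter_join_fam F n (x : 'I_n.+1 -> A) :
  prime_one_filter F -> F (join_fam x) -> exists i, F (x i).
Proof.
move=> [_ Fpr]; rewrite /join_fam; elim/big_rec: _ => [|j y _ IH].
  by exists ord0.
by move=> /Fpr[]; [exists (lift ord0 j)|].
Qed.

Lemma decomposable_join_seq x s a b : decomposable A -> join_seq x s = pone ->
  (forall y, y \in x :: s -> Cg [set (y, pone)] (a, b)) -> a = b.
Proof.
move=> dec eq1 ab.
(* Decomposability speaks of families of length at least 2, so [x] is repeated to cover an empty
   [s]. *)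
have := dec _ (fun i : 'I_(size s).+2 => nth x (x :: x :: s) i).
rewrite (@join_fam_seq _ _ x (x :: s)) /=.
have -> : Order.join x (join_seq x s) = pone.
  by rewrite eq1; apply: join_r; rewrite -eq1 le_join_seq ?mem_head.
move=> /(_ erefl)/bigcap_Cg_diagonal; apply => i; apply: ab.
have := mem_nth x (ltn_ord i : (_ < size (x :: x :: s))%N).
by rewrite !inE orbA orbb.
Qed.

End Congruences.

(** * Prime filters separating points *)

Section Separation.
Variables (d : Order.disp_t) (A : pointedLatticeType d).
Implicit Types (X D F : set A) (x y a b : A).

(* An ideal may be empty here; its complement is then the improper filter. *)
Record ideal X : Prop := Ideal {
  ideal_down : forall a b, a <= b -> X b -> X a;
  ideal_join : forall a b, X a -> X b -> X (Order.join a b)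
}.

(** The list [x :: s] is nonempty since an empty join may not exist; an empty [D] generates the
    empty ideal. *)
Definition ideal_gen D : set A := [set w | exists x s,
  {in x :: s, forall y, D y} /\ w <= join_seq x s].

Lemma ideal_gen_ideal D : ideal (ideal_gen D).
Proof.
split=> [a b ab [x [s [Ds bs]]]|a b [x [s [Ds bs]]] [y [t [Dt bt]]]].
  by exists x, s; split => //; exact: le_trans bs.
exists x, (s ++ y :: t); split.
  move=> z; rewrite -cat_cons mem_cat => /orP[]; [exact: Ds|exact: Dt].
rewrite leUx; apply/andP; split.
  apply: le_trans bs _; rewrite join_seq_le; apply/allP => z zs.
  by apply: le_join_seq; rewrite -cat_cons mem_cat zs.
apply: le_trans bt _; rewrite join_seq_le; apply/allP => z zs.
by apply: le_join_seq; rewrite -cat_cons mem_cat zs orbT.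
Qed.

Lemma ideal_complement_prime X : ideal X -> ~ X pone ->
  (forall a b, ~ X a -> ~ X b -> ~ X (Order.meet a b)) ->
  prime_one_filter (~` X).
Proof.
move=> [Xdown XU] X1 XI; split; first split=> // a b ab nXa Xb.
  by apply: nXa; exact: Xdown Xb.
by move=> a b nXab; apply: contrapT => /not_orP[/contrapT Xa /contrapT Xb];
  apply: nXab; exact: XU.
Qed.

Lemma maximal_ideal X : ideal X -> ~ X pone ->
  exists M, [/\ ideal M, ~ M pone, X `<=` M &
    forall N, ideal N -> M `<=` N -> ~ N pone -> N `<=` M].
Proof.
move=> [Xdown XU] X1.
(* Zorn's lemma also tests the empty chain, whose union is empty; adding [X] inside [P] makes the
   empty set qualify. *)
pose P : set (set A) := [set Y | ideal (Y `|` X) /\ ~ Y pone].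
have [|Y [[Yid Y1] Ymax]] := @Zorn_bigcup _ P.
  move=> C CP Ctot; split; last by move=> [Y /CP[_ Y1] /Y1].
  split=> [a b ab [[Y CY Yb]|Xb]|a b].
  - have [[Ydown _] _] := CP _ CY.
    by have [Ya|Xa] := Ydown _ _ ab (or_introl Yb); [left; exists Y|right].
  - by right; exact: Xdown Xb.
  have one Y : C Y -> (Y `|` X) a -> (Y `|` X) b ->
      (\bigcup_(Y in C) Y `|` X) (Order.join a b).
    move=> CY Ya Yb; have [[_ YU] _] := CP _ CY.
    by have [Yab|Xab] := YU _ _ Ya Yb; [left; exists Y|right].
  move=> [[Y CY Ya]|Xa] [[Z CZ Zb]|Xb].
  - have [YZ|ZY] := Ctot _ _ CY CZ.
      by apply: (one Z) => //; left => //; exact: YZ.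
    by apply: (one Y) => //; left => //; exact: ZY.
  - by apply: (one Y) => //; [left|right].
  - by apply: (one Z) => //; [right|left].
  - by right; exact: XU.
exists (Y `|` X); split=> // [[]//|N Nid YN N1].
have [Y'|] := pselect (Y = N); first by rewrite -Y' => z; left.
move=> YneN; exfalso; apply: (Ymax N).
  split=> [z Yz|NY]; first by apply: YN; left.
  by apply: YneN; apply/seteqP; split => // z Yz; apply: YN; left.
split=> //; suff -> : N `|` X = N by [].
by apply/setUidl => z Xz; apply: YN; right.
Qed.

Lemma prime_filter_separation D : up_distributive A ->
  (forall x s, {in x :: s, forall y, D y} -> ~ pone <= join_seq x s) ->
  exists2 F, prime_one_filter F & forall f, F f -> ~ D f.
Proof.
move=> ud D1; have [||M [Mid M1 DM Mmax]] := @maximal_ideal (ideal_gen D).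
- exact: ideal_gen_ideal.
- by move=> [x [s [/D1]]].
exists (~` M); last first.
  move=> f Mf Df; apply/Mf/DM; exists f, [::].
  by split=> // y; rewrite inE => /eqP->.
have [Mdown MU] := Mid.
(* By maximality the ideal generated by [M] and [y] contains [pone]. The first alternative covers an
   empty [M]. *)
have above y : ~ M y -> pone <= y \/ exists2 m, M m & pone <= Order.join m y.
  move=> My; apply: contrapT => /not_orP[y1 my1].
  pose N := [set w | w <= y \/ exists2 m, M m & w <= Order.join m y].
  apply/My/(Mmax N) => //; last 1 first.
  - by left.
  - split=> [a b ab [yb|[m Mm mb]]|a b [ya|[m Mm ma]] [yb|[n Mn nb]]].
    + by left; exact: le_trans yb.
    + by right; exists m => //; exact: le_trans mb.
    + by left; rewrite leUx ya.
    + by right; exists n => //; rewrite leUx nb (le_trans ya)// leUr.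
    + by right; exists m => //; rewrite leUx ma (le_trans yb)// leUr.
    + right; exists (Order.join m n); first exact: MU.
      by rewrite leUx (le_trans ma) ?(le_trans nb)// leU2 ?leUl ?leUr.
  - by move=> z Mz; right; exists z => //; rewrite leUl.
  - by case.
apply: ideal_complement_prime => // y z My Mz Myz.
suff [m /MU/(_ Myz) Mm m1] :
  exists2 m, M m & pone <= Order.join m (Order.meet y z).
  by apply: M1; exact: Mdown Mm.
have [y1|[m Mm my]] := above _ My; have [z1|[n Mn nz]] := above _ Mz.
(* No [m] comes from [above] here, but [y /\ z] itself lies in [M] by [Myz]. *)
- by exists (Order.meet y z) => //; rewrite joinxx lexI y1.
- by exists n => //; apply: ud => //; rewrite (le_trans y1)// leUr.
- by exists m => //; apply: ud => //; rewrite (le_trans z1)// leUr.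
- exists (Order.join m n); first exact: MU.
  by apply: ud; [apply: le_trans my _|apply: le_trans nz _];
    rewrite leU2 ?leUl ?leUr.
Qed.

Lemma decomposable_some_family :
  up_distributive A -> decomposable A -> some_family_separates A.
Proof.
move=> ud dec; exists {F : set A | prime_one_filter F}, (@sval _ _).
split; first by case.
apply/bigcap_Cg_diagonal => a b ab; apply: contrapT => neq_ab.
pose D := [set x : A | Cg [set (Order.meet x pone, pone)] (a, b)].
have [|F Fpr FD] := @prime_filter_separation D ud.
  (* Decomposability needs a join equal to [pone], not merely above it; truncation supplies this. *)
  move=> x s Ds /(up_distributive_join_seq ud) le1; apply: neq_ab.
  apply: (decomposable_join_seq (x := Order.meet x pone)
    (s := [seq Order.meet y pone | y <- s]) dec).
    apply/le_anti; rewrite le1 andbT join_seq_le /= leIr /=.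
    by apply/allP => _ /mapP[y _ ->]; exact: leIr.
  by move=> y /(mapP (s := x :: s))[z zs ->]; exact: Ds.
have := ab (exist _ F Fpr).
rewrite -/(Theta_plus F) Theta_plus_union; last by case: Fpr.
by move=> [f /FD].
Qed.

(** For [a] not above the point, separation applies to the singleton of [a], since joins of copies
    of [a] stay below [a]. *)
Lemma bigcap_prime_filters : up_distributive A ->
  \bigcap_(F in prime_one_filter (A := A)) F = up_one A.
Proof.
move=> ud; apply/seteqP; split=> a; last first.
  by move=> a1 F [[F1 Fup _] _]; exact: Fup F1.
move=> aF; apply: contrapT => a1.
have [|F Fpr Fa] := @prime_filter_separation [set a] ud.
  move=> x s Ds /le_trans s1; apply: a1; apply: s1.
  by rewrite join_seq_le; apply/allP => y /Ds ->; exact: lexx.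
by apply: (Fa a) => //; exact: aF.
Qed.

Lemma every_family_some_family :
  up_distributive A -> every_family_separates A -> some_family_separates A.
Proof.
move=> ud ev; exists {F : set A | prime_one_filter F}, (@sval _ _).
split; first by case.
apply: ev; [|by case|].
  (* The improper filter shows that the index type is inhabited. *)
  by constructor; exists setT; split; [split|left].
rewrite -bigcap_prime_filters//; apply/seteqP; split=> a aF.
  by move=> F Fpr; have := aF (exist _ F Fpr) I.
by move=> [F Fpr] _; exact: aF.
Qed.

(** The generator is the meet of [pone] with all members of [F] in an enumeration of [A]. *)
Lemma principal_one_filter F : finite_set [set: A] -> one_filter F ->
  exists p, [/\ F p, p <= pone & forall f, F f -> p <= f].
Proof.
move=> /finite_seqP[s sE] [F1 Fup FI].
have [p [Fp p1 pF]] : exists p, [/\ F p, p <= pone &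
    forall f, f \in s -> F f -> p <= f].
  elim: s {sE} => [|x s [p [Fp p1 ps]]]; first by exists pone.
  have [Fx|Fx] := pselect (F x); last first.
    by exists p; split=> // f; rewrite inE => /orP[/eqP->//|]; exact: ps.
  exists (Order.meet x p); split; [exact: FI|by rewrite leIx2// p1 orbT|].
  move=> f; rewrite inE => /orP[/eqP->|fs Ff]; first by rewrite leIl.
  by rewrite leIx2// ps ?orbT.
exists p; split=> // f Ff; apply: pF => //.
by have : [set: A] f by []; rewrite sE.
Qed.

Lemma decomposable_every_family : finite_set [set: A] ->
  decomposable A -> every_family_separates A.
Proof.
move=> finA dec I F [i0] Fpr FE.
have /choice[p pP] : forall i, exists p,
    [/\ F i p, p <= pone & forall f, F i f -> p <= f].
  by move=> i; apply: principal_one_filter => //; case: (Fpr i).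
apply/bigcap_Cg_diagonal => a b ab; have /finite_seqP[s0 s0E] := finA.
(* [I] may be infinite, but the generators [p i] take finitely many values; the head [p i0] added
   below keeps the list nonempty. *)
pose s := [seq y <- s0 | `[< exists i, y = p i >]].
have sP y : y \in p i0 :: s <-> exists i, y = p i.
  rewrite inE mem_filter; split=> [/orP[/eqP->|/andP[/asboolP//]]|yp].
    by exists i0.
  apply/orP; right; apply/andP; split; first exact/asboolP.
  by have : [set: A] y by []; rewrite s0E.
apply: (decomposable_join_seq (x := p i0) (s := s) dec).
  apply/le_anti/andP; split.
    by rewrite join_seq_le; apply/allP => y /sP[i ->]; have [] := pP i.
  suff : (\bigcap_(i in [set: I]) F i) (join_seq (p i0) s) by rewrite FE.
  move=> i _; have [[_ Fup _] _] := Fpr i; have [Fp _ _] := pP i.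
  by apply: Fup Fp; apply/le_join_seq/sP; exists i.
move=> y /sP[i ->]; have := ab i; have [Fp p1 pF] := pP i.
(* Since [p i <= f /\ 1 <= 1], the congruence of [p i] contains each generator of
   [Theta_plus (F i)]. *)
apply: smallest_sub; first exact: Cg_congruence.
move=> _ [f Ff <-]; apply: (@Cg1_anti _ _ (p i) (Order.meet f pone)).
- by rewrite lexI p1 pF.
- by rewrite leIr.
- exact: sub_gen_smallest.
Qed.

End Separation.

(** * Quotient of a pointed lattice by a congruence *)

Section Quotient.
Local Open Scope quotient_scope.
Variables (d : Order.disp_t) (A : pointedLatticeType d).
Variables (R : set (A * A)) (cR : congruence R).

Definition congr_rel : rel A := fun x y => `[< R (x, y) >].

Lemma congr_rel_refl : reflexive congr_rel.
Proof. by move=> x; apply/asboolP; exact: congr_refl. Qed.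

Lemma congr_rel_sym : symmetric congr_rel.
Proof. by move=> x y; apply/asboolP/asboolP; exact: congr_sym. Qed.

Lemma congr_rel_trans : transitive congr_rel.
Proof.
by move=> y x z /asboolP xy /asboolP yz; apply/asboolP; exact: congr_trans yz.
Qed.

Definition congr_equiv : equiv_rel A :=
  EquivRel congr_rel congr_rel_refl congr_rel_sym congr_rel_trans.

Definition quotient : Type := {eq_quot congr_equiv}.
HB.instance Definition _ := Choice.copy quotient {eq_quot congr_equiv}.

Definition to_quotient (x : A) : quotient := \pi_{eq_quot congr_equiv} x.
Definition of_quotient (u : quotient) : A := repr (u : {eq_quot congr_equiv}).

Lemma of_quotientK : cancel of_quotient to_quotient.
Proof. by move=> u; rewrite /to_quotient /of_quotient reprK. Qed.

Lemma eq_to_quotient x y : to_quotient x = to_quotient y <-> R (x, y).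
Proof.
split=> [/(eqmodP congr_equiv)/asboolP//|Rxy].
exact/(eqmodP congr_equiv)/asboolP.
Qed.

Lemma to_quotientK x : R (of_quotient (to_quotient x), x).
Proof. by apply/eq_to_quotient; rewrite of_quotientK. Qed.

Definition quotient_meet (u v : quotient) : quotient :=
  to_quotient (Order.meet (of_quotient u) (of_quotient v)).
Definition quotient_join (u v : quotient) : quotient :=
  to_quotient (Order.join (of_quotient u) (of_quotient v)).
(** Reading the order off the meet lets the lattice structure below be built with [erefl] for their
    compatibility. *)
Definition quotient_le (u v : quotient) := quotient_meet u v == u.

Lemma to_quotient_meet x y :
  to_quotient (Order.meet x y) = quotient_meet (to_quotient x) (to_quotient y).
Proof.
by apply/eq_to_quotient/(congr_sym cR)/(congr_meet cR); exact: to_quotientK.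
Qed.

Lemma to_quotient_join x y :
  to_quotient (Order.join x y) = quotient_join (to_quotient x) (to_quotient y).
Proof.
by apply/eq_to_quotient/(congr_sym cR)/(congr_join cR); exact: to_quotientK.
Qed.

Lemma quotient_meetC : commutative quotient_meet.
Proof. by move=> u v; rewrite /quotient_meet meetC. Qed.

Lemma quotient_joinC : commutative quotient_join.
Proof. by move=> u v; rewrite /quotient_join joinC. Qed.

(** Every class is the image of its representative and the projection preserves the operations, so
    identities transfer from [A], here and below. *)
Lemma quotient_meetA : associative quotient_meet.
Proof.
move=> u v w; rewrite -[u]of_quotientK -[v]of_quotientK -[w]of_quotientK.
by rewrite -!to_quotient_meet meetA.
Qed.

Lemma quotient_joinA : associative quotient_join.
Proof.
move=> u v w; rewrite -[u]of_quotientK -[v]of_quotientK -[w]of_quotientK.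
by rewrite -!to_quotient_join joinA.
Qed.

Lemma quotient_joinKI v u : quotient_meet u (quotient_join u v) = u.
Proof.
rewrite -[u]of_quotientK -[v]of_quotientK.
by rewrite -to_quotient_join -to_quotient_meet joinKI.
Qed.

Lemma quotient_meetKU v u : quotient_join u (quotient_meet u v) = u.
Proof.
rewrite -[u]of_quotientK -[v]of_quotientK.
by rewrite -to_quotient_meet -to_quotient_join meetKU.
Qed.

Lemma quotient_le_refl : reflexive quotient_le.
Proof.
move=> u; rewrite /quotient_le -[u]of_quotientK.
by rewrite -to_quotient_meet meetxx.
Qed.

Lemma quotient_le_anti : antisymmetric quotient_le.
Proof.
by move=> u v /andP[/eqP uv /eqP vu]; rewrite -uv quotient_meetC vu.
Qed.

Lemma quotient_le_trans : transitive quotient_le.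
Proof.
move=> v u w /eqP uv /eqP vw; apply/eqP.
by rewrite -uv -quotient_meetA vw.
Qed.

HB.instance Definition _ := Order.Le_isPOrder.Build d quotient
  quotient_le_refl quotient_le_anti quotient_le_trans.
HB.instance Definition _ := Order.POrder_isLattice.Build d quotient
  quotient_meetC quotient_joinC quotient_meetA quotient_joinA
  quotient_joinKI quotient_meetKU (fun _ _ => erefl).
HB.instance Definition _ := isPointedLattice.Build d quotient (to_quotient pone).

(** This explains the generators of [Theta_plus F]: it is the least congruence whose quotient sends
    all of [F] above the point. *)
Lemma pone_le_to_quotient x :
  pone <= to_quotient x <-> R (Order.meet x pone, pone).
Proof.
rewrite leEmeet -[Order.meet _ _]/(quotient_meet (to_quotient pone) _).
rewrite quotient_meetC -to_quotient_meet.
by split=> [/eqP/eq_to_quotient|/eq_to_quotient/eqP].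
Qed.

End Quotient.

(** * Subdirect representations and the equivalences *)

Section SemiPrimePointed.
Variables (d : Order.disp_t) (A : pointedLatticeType d).

Lemma quotient_prime_pointed (F : set A) :
  prime_one_filter F ->
  prime_pointed (quotient (Cg_congruence _ : congruence (Theta_plus F))).
Proof.
move=> Fpr; set cR := Cg_congruence _; have [[F1 Fup FI] FU] := Fpr.
have in_filter x : pone <= to_quotient cR x <-> F x.
  rewrite pone_le_to_quotient; split=> [/(Theta_plus_prime Fpr)[_ F1x]|Fx].
    by apply: Fup (F1x F1); rewrite leIl.
  by apply: sub_gen_smallest; exists x.
move=> u v; rewrite -[u]of_quotientK -[v]of_quotientK.
rewrite -[Order.join _ _]/(quotient_join _ _) -to_quotient_join.
by rewrite !in_filter; exact: FU.
Qed.

Lemma some_family_semi_prime : some_family_separates A -> semi_prime_pointed A.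
Proof.
move=> [I [F [Fpr FE]]].
pose cR i := Cg_congruence [set (Order.meet f pone, pone) | f in F i].
pose B i : pointedLatticeType d := quotient (cR i).
pose f (a : A) i : B i := to_quotient (cR i) a.
have f1 : f pone = @prod_one d I B by [].
have fI x y : f (Order.meet x y) = prod_meet (f x) (f y).
  by apply: functional_extensionality_dep => i; exact: to_quotient_meet.
have fU x y : f (Order.join x y) = prod_join (f x) (f y).
  by apply: functional_extensionality_dep => i; exact: to_quotient_join.
exists I, B, (range f), f; split.
- by move=> i; apply: quotient_prime_pointed.
- split.
  + by exists pone.
  + by move=> _ _ [x _ <-] [y _ <-]; exists (Order.meet x y).
  + by move=> _ _ [x _ <-] [y _ <-]; exists (Order.join x y).
  + move=> i b; exists (f (of_quotient b)); first by exists (of_quotient b).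
    exact: of_quotientK.
- split=> // x y fxy; move/bigcap_Cg_diagonal: FE; apply => i.
  by apply/(eq_to_quotient (cR i)); rewrite -/(f x i) fxy.
Qed.

(** Trades the subdirect product for a jointly injective family of homomorphisms, so that later
    arguments run in one coordinate. *)
Lemma semi_prime_coordinates : semi_prime_pointed A ->
  exists (I : Type) (B : I -> pointedLatticeType d) (f : forall i, A -> B i),
  [/\ forall i, prime_pointed (B i),
      forall i, f i pone = pone,
      forall i, {morph f i : x y / Order.meet x y},
      forall i, {morph f i : x y / Order.join x y}
    & forall x y, (forall i, f i x = f i y) -> x = y].
Proof.
move=> [I [B [S [f [Bpr _ [f1 fI fU finj _]]]]]].
exists I, B, (fun i x => f x i); split=> //.
- by move=> i; rewrite f1.
- by move=> i x y; rewrite fI.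
- by move=> i x y; rewrite fU.
- by move=> x y fxy; apply: finj; exact: functional_extensionality_dep.
Qed.

Section Coordinates.
Variables (I : Type) (B : I -> pointedLatticeType d) (f : forall i, A -> B i).
Hypotheses (Bpr : forall i, prime_pointed (B i)) (f1 : forall i, f i pone = pone)
  (fI : forall i, {morph f i : x y / Order.meet x y})
  (fU : forall i, {morph f i : x y / Order.join x y})
  (finj : forall x y, (forall i, f i x = f i y) -> x = y).

Lemma coordinate_le i x y : x <= y -> f i x <= f i y.
Proof. by rewrite !leEmeet -fI => /eqP->. Qed.

Lemma coordinates_le x y : (forall i, f i x <= f i y) -> x <= y.
Proof.
move=> fxy; rewrite leEmeet; apply/eqP/finj => i; rewrite fI.
exact/meet_l/fxy.
Qed.

Lemma coordinate_filter i : prime_one_filter [set a | pone <= f i a].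
Proof.
split; first split=> [|a b /(coordinate_le i) ab fa|a b fa fb] /=.
- by rewrite f1.
- exact: le_trans ab.
- by rewrite fI lexI fa.
- by move=> a b /=; rewrite fU; exact: Bpr.
Qed.

Lemma coordinate_kernel i : congruence [set p | f i p.1 = f i p.2].
Proof.
split=> /= [//|//|x y z -> //|x x' y y' xx' yy'|x x' y y' xx' yy'].
  by rewrite !fI xx' yy'.
by rewrite !fU xx' yy'.
Qed.

(** In each coordinate primality puts [x] or [y] above the point, and then one of the two meets
    already suffices. *)
Lemma coordinates_alpha2 : alpha2 A.
Proof.
move=> x y z xy; apply: coordinates_le => i; rewrite fU !fI f1.
have : pone <= Order.join (f i x) (f i y) by rewrite -fU -(f1 i) coordinate_le.
by move=> /Bpr[] le1; [rewrite lexUl|rewrite lexUr]; rewrite // leI2.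
Qed.

(** In coordinate [i] some [x j] lies above the point by primality and below it as part of the join,
    so the kernel contains [(x j, pone)]. *)
Lemma coordinates_decomposable : decomposable A.
Proof.
move=> n x x1; apply/bigcap_Cg_diagonal => a b ab; apply: finj => i.
have [|j /= xj] := @prime_filter_join_fam _ A _ _ x (coordinate_filter i).
  by rewrite x1 /= f1.
apply: (Cg1_sub (coordinate_kernel i) _ (ab j)) => /=.
apply/le_anti; rewrite f1 xj andbT -(f1 i); apply: coordinate_le.
by rewrite -x1 le_join_fam.
Qed.

(** [Theta_plus] of the filter attached to a coordinate lies inside the kernel of that coordinate,
    and the kernels meet in the diagonal. *)
Lemma coordinates_some_family : some_family_separates A.
Proof.
exists I, (fun i => [set a | pone <= f i a]); split; first exact: coordinate_filter.
apply/bigcap_Cg_diagonal => a b ab; apply: finj => i.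
apply: (@smallest_sub _ _ _ [set p | f i p.1 = f i p.2] _ _ _ (ab i)).
  exact: coordinate_kernel.
by move=> _ [g g1 <-] /=; rewrite fI f1; exact: meet_r.
Qed.

End Coordinates.

Lemma semi_prime_alpha2 : semi_prime_pointed A -> alpha2 A.
Proof.
by move=> /semi_prime_coordinates[I [B [f [Bpr f1 fI fU finj]]]];
  exact: coordinates_alpha2 finj.
Qed.

Lemma semi_prime_decomposable : semi_prime_pointed A -> decomposable A.
Proof.
by move=> /semi_prime_coordinates[I [B [f [Bpr f1 fI fU finj]]]];
  exact: coordinates_decomposable finj.
Qed.

Lemma semi_prime_some_family : semi_prime_pointed A -> some_family_separates A.
Proof.
by move=> /semi_prime_coordinates[I [B [f [Bpr f1 fI fU finj]]]];
  exact: coordinates_some_family finj.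
Qed.

End SemiPrimePointed.

Theorem theorem2p9 (d : Order.disp_t) (A : pointedLatticeType d) :
  [/\ semi_prime_pointed A <-> up_distributive A /\ decomposable A,
      semi_prime_pointed A <-> alpha2 A /\ decomposable A,
      semi_prime_pointed A <-> some_family_separates A
    & finite_set [set: A]%classic ->
        (semi_prime_pointed A <->
         up_distributive A /\ every_family_separates A)].
Proof.
have ud : semi_prime_pointed A -> up_distributive A.
  by move=> /semi_prime_alpha2/alpha2_up_distributive.
split=> [|||finA]; split.
- by move=> spp; split; [exact: ud|exact: semi_prime_decomposable].
- by move=> [udA dec]; apply/some_family_semi_prime/decomposable_some_family.
- by move=> spp; split; [exact: semi_prime_alpha2|exact: semi_prime_decomposable].
- move=> [/alpha2_up_distributive udA dec].
  exact/some_family_semi_prime/decomposable_some_family.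
- exact: semi_prime_some_family.
- exact: some_family_semi_prime.
- move=> spp; split; first exact: ud.
  by apply: decomposable_every_family => //; exact: semi_prime_decomposable.
- by move=> [udA ev]; apply/some_family_semi_prime/every_family_some_family.
Qed.
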